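(* Every $\lambda$-cyclic skew left brace is symmetric.
   Context: A skew left brace is a triple $(G, \cdot, \circ)$ where $(G,\cdot)$ and $(G,\circ)$ are groups and $g_1 \circ (g_2 \cdot g_3) = (g_1 \circ g_2)\cdot g_1^{-1} \cdot (g_1 \circ g_3)$ for all $g_1,g_2,g_3 \in G$, where $g_1^{-1}$ is the inverse in $(G,\cdot)$. For $a \in G$ the map $\lambda_a : b \mapsto a^{-1}\cdot(a \circ b)$ is an automorphism of $(G,\cdot)$, and $a \mapsto \lambda_a$ is a group homomorphism $(G,\circ) \to \operatorname{Aut}(G,\cdot)$. The skew left brace is $\lambda$-homomorphic if $\lambda : (G,\cdot) \to \operatorname{Aut}(G,\cdot)$, $a \mapsto \lambda_a$, is also a group homomorphism, and $\lambda$-cyclic if it is $\lambda$-homomorphic and $\operatorname{Im}\lambda$ is a cyclic subgroup of $\operatorname{Aut}(G,\cdot)$. A skew left brace $(G,\cdot,\circ)$ is symmetric if $(G, \circ, \cdot)$ is also a skew left brace. *)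

(* Defs.v *)
From mathcomp Require Import all_boot all_order all_algebra.
From mathcomp Require Import boolp.

Set Implicit Arguments.
Unset Strict Implicit.
Unset Printing Implicit Defensive.

(* A skew left brace carries two group structures on one carrier, whose roles
   are exchanged when speaking of symmetry. They are therefore kept as explicit
   data rather than as canonical groupType instances, which would also confine
   us to choice types. The group need not be finite. *)
Record group_law (G : Type) := GroupLaw {
  gmul :> G -> G -> G;
  gone : G;
  ginv : G -> G;
  gmulA : associative gmul;
  gmul1g : left_id gone gmul;
  gmulg1 : right_id gone gmul;
  gmulVg : left_inverse gone ginv gmul;
  gmulgV : right_inverse gone ginv gmul
}.

Definition group_hom (G H : Type) (mG : group_law G) (mH : group_law H)
    (f : G -> H) : Prop :=
  forall x y, f (mG x y) = mH (f x) (f y).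

Definition gexpn (G : Type) (m : group_law G) (x : G) (n : nat) : G :=
  iter n (m x) (gone m).

(* Negz n stands for the integer - n.+1. *)
Definition gexpz (G : Type) (m : group_law G) (x : G) (z : int) : G :=
  match z with
  | Posz n => gexpn m x n
  | Negz n => ginv m (gexpn m x n.+1)
  end.

Definition cyclic_subgroup (G : Type) (m : group_law G) (S : G -> Prop) : Prop :=
  exists g : G, forall x : G, S x <-> exists z : int, x = gexpz m g z.

(* The inverse map is stored so that inversion in Aut(G) needs no choice; it is
   determined by the underlying map (see aut_eq). *)
Record aut (G : Type) (m : group_law G) := Aut {
  aut_fun :> G -> G;
  aut_inv : G -> G;
  aut_funK : cancel aut_fun aut_inv;
  aut_invK : cancel aut_inv aut_fun;
  aut_hom : group_hom m m aut_fun
}.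

Section AutGroup.

Variables (G : Type) (m : group_law G).
Implicit Types f g h : aut m.

Lemma aut_eq f g : (forall x, f x = g x) -> f = g.
Proof.
case: f => f f' fK f'K fM; case: g => g g' gK g'K gM /= fg.
have {}fg : f = g by exact: funext.
subst g.
have f'g' : f' = g' by apply: funext => x; rewrite -[x in LHS]g'K fK.
by subst g'; congr Aut; exact: Prop_irrelevance.
Qed.

Lemma aut_inv_hom f : group_hom m m (aut_inv f).
Proof. by move=> x y; rewrite -{1}[x](aut_invK f) -{1}[y](aut_invK f) -aut_hom aut_funK. Qed.

Lemma aut_comp_hom f g : group_hom m m (f \o g).
Proof. by move=> x y /=; rewrite !aut_hom. Qed.

Definition aut_one : aut m :=
  @Aut G m id id (fun _ => erefl) (fun _ => erefl) (fun _ _ => erefl).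

Definition aut_mul f g : aut m :=
  Aut (can_comp (aut_funK f) (aut_funK g))
      (can_comp (aut_invK g) (aut_invK f))
      (@aut_comp_hom f g).

Definition aut_opp f : aut m :=
  Aut (aut_invK f) (aut_funK f) (@aut_inv_hom f).

Lemma aut_mulA : associative aut_mul.
Proof. by move=> f g h; exact: aut_eq. Qed.

Lemma aut_mul1g : left_id aut_one aut_mul.
Proof. by move=> f; exact: aut_eq. Qed.

Lemma aut_mulg1 : right_id aut_one aut_mul.
Proof. by move=> f; exact: aut_eq. Qed.

Lemma aut_mulVg : left_inverse aut_one aut_opp aut_mul.
Proof. by move=> f; apply: aut_eq => x /=; rewrite aut_funK. Qed.

Lemma aut_mulgV : right_inverse aut_one aut_opp aut_mul.
Proof. by move=> f; apply: aut_eq => x /=; rewrite aut_invK. Qed.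

Definition aut_group : group_law (aut m) :=
  GroupLaw aut_mulA aut_mul1g aut_mulg1 aut_mulVg aut_mulgV.

End AutGroup.

Definition is_skew_left_brace (G : Type) (dot circ : group_law G) : Prop :=
  forall g1 g2 g3 : G,
    circ g1 (dot g2 g3) = dot (dot (circ g1 g2) (ginv dot g1)) (circ g1 g3).

Record skew_left_brace := SkewLeftBrace {
  brace_sort :> Type;
  dot : group_law brace_sort;
  circ : group_law brace_sort;
  braceP : is_skew_left_brace dot circ
}.

Arguments dot {_}.
Arguments circ {_}.

Section Lambda.

Variable B : skew_left_brace.
Implicit Types a b : B.

Definition lambda_fun a b : B := dot (ginv dot a) (circ a b).

Definition lambda_inv a b : B := circ (ginv circ a) (dot a b).

Lemma lambda_funK a : cancel (lambda_fun a) (lambda_inv a).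
Proof.
move=> b; rewrite /lambda_fun /lambda_inv.
by rewrite (gmulA dot) gmulgV gmul1g (gmulA circ) gmulVg gmul1g.
Qed.

Lemma lambda_invK a : cancel (lambda_inv a) (lambda_fun a).
Proof.
move=> b; rewrite /lambda_fun /lambda_inv.
by rewrite (gmulA circ) gmulgV gmul1g (gmulA dot) gmulVg gmul1g.
Qed.

Lemma lambda_hom a : group_hom dot dot (lambda_fun a).
Proof. by move=> b c; rewrite /lambda_fun braceP !(gmulA dot). Qed.

Definition lambda a : aut (@dot B) :=
  Aut (lambda_funK a) (lambda_invK a) (lambda_hom a).

Definition lambda_image (f : aut (@dot B)) : Prop := exists a, f = lambda a.

End Lambda.

Definition lambda_homomorphic (B : skew_left_brace) : Prop :=
  group_hom (@dot B) (aut_group (@dot B)) (@lambda B).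

Definition lambda_cyclic (B : skew_left_brace) : Prop :=
  lambda_homomorphic B /\ cyclic_subgroup (aut_group (@dot B)) (@lambda_image B).

Definition symmetric_brace (B : skew_left_brace) : Prop :=
  is_skew_left_brace (@circ B) (@dot B).

(* Main.v *)
From mathcomp Require Import all_boot all_order all_algebra.
Require Import Defs.

(** Since a o b = a . lambda_a b, both sides of the symmetric brace identity
    a . (b o c) = (a . b) o a' o (a . c), with a' the inverse of a for o,
    expand in terms of lambda. For a lambda-homomorphic brace whose lambda maps
    commute, lambda_(a . b) a' = lambda_b (lambda_a a') = lambda_b (a^-1), and
    (a . b) o a' acts as lambda_b, so the right-hand side is
    a . b . lambda_b (a^-1 . a . c) = a . b . lambda_b c. Cyclicity serves only
    to make the lambda maps commute. *)

Section GroupLaw.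

Set Implicit Arguments.
Unset Strict Implicit.

Variables (G : Type) (m : group_law G).
Implicit Types x y : G.

Lemma gmulKg x y : m (ginv m x) (m x y) = y.
Proof. by rewrite gmulA gmulVg gmul1g. Qed.

Lemma gmulKVg x y : m x (m (ginv m x) y) = y.
Proof. by rewrite gmulA gmulgV gmul1g. Qed.

Lemma gmulgI x y z : m x y = m x z -> y = z.
Proof. by move=> e; rewrite -(gmulKg x y) e gmulKg. Qed.

Lemma gcommX x y n : m x y = m y x -> m x (gexpn m y n) = m (gexpn m y n) x.
Proof.
move=> cxy; elim: n => [|n IHn]; first by rewrite /gexpn /= gmulg1 gmul1g.
rewrite /gexpn iterS -/(gexpn m y n).
by rewrite gmulA cxy -gmulA IHn gmulA.
Qed.

Lemma gcommV x y : m x y = m y x -> m x (ginv m y) = m (ginv m y) x.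
Proof.
by move=> cxy; apply: (@gmulgI y); rewrite gmulKVg gmulA -cxy -gmulA gmulgV gmulg1.
Qed.

Lemma gcommXz x y z : m x y = m y x -> m x (gexpz m y z) = m (gexpz m y z) x.
Proof.
by move=> cxy; case: z => n; [exact: gcommX | exact: gcommV (gcommX n.+1 cxy)].
Qed.

Lemma cyclic_subgroup_comm (S : G -> Prop) :
  cyclic_subgroup m S -> forall x y, S x -> S y -> m x y = m y x.
Proof.
case=> g Sg x y /Sg[z ->] /Sg[w ->].
(* Commutation with [g] passes to its powers: first for [w] with [g^z] fixed, then for [z]. *)
by apply: gcommXz; apply/esym; exact: gcommXz.
Qed.

End GroupLaw.

Section Brace.

Set Implicit Arguments.
Unset Strict Implicit.

Variable B : skew_left_brace.
Implicit Types a b c : B.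

Lemma circE a b : circ a b = dot a (lambda a b).
Proof. by rewrite /= /lambda_fun gmulKVg. Qed.

(** The brace identity at the [circ] identity and two [dot] identities says that the [dot] inverse
    of the former is trivial. *)
Lemma gone_circ : gone (@circ B) = gone dot.
Proof.
have := braceP (gone (@circ B)) (gone dot) (gone dot).
rewrite !gmul1g gmulg1 => e.
by rewrite -[LHS](gmulg1 dot) [X in dot _ X]e gmulgV.
Qed.

Lemma lambda1 b : lambda (gone (@circ B)) b = b.
Proof.
apply: (@gmulgI _ dot (gone circ)).
by rewrite -circE gmul1g gone_circ gmul1g.
Qed.

Lemma lambda_ginv_circ a : lambda a (ginv circ a) = ginv dot a.
Proof. by rewrite /= /lambda_fun gmulgV gone_circ gmulg1. Qed.

(** Multiplied on the left by [circ a b], this is associativity of [circ]. *)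
Lemma lambda_circ a b c : lambda (circ a b) c = lambda a (lambda b c).
Proof.
apply: (@gmulgI _ dot (circ a b)).
by rewrite -circE -gmulA (circE b) (circE a) aut_hom gmulA -circE.
Qed.

Lemma lambda_comm_symmetric :
    lambda_homomorphic B ->
    (forall a b c, lambda a (lambda b c) = lambda b (lambda a c)) ->
  symmetric_brace B.
Proof.
move=> lamM lamC a b c.
have lam_dot x : lambda (dot a b) x = lambda a (lambda b x) by rewrite lamM.
(* The left side is the conjugate of [lambda b] by [lambda a], so commutation makes it
   [lambda b]. *)
have lamE x : lambda (circ (dot a b) (ginv circ a)) x = lambda b x.
  by rewrite lambda_circ lam_dot lamC -(lambda_circ a) gmulgV lambda1.
rewrite [RHS]circE lamE (circE (dot a b)) lam_dot lamC lambda_ginv_circ.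
by rewrite -[RHS]gmulA -aut_hom gmulKg -[RHS]gmulA -circE.
Qed.

End Brace.

Theorem theorem5p7 (B : skew_left_brace) : lambda_cyclic B -> symmetric_brace B.
Proof.
case=> lamM /cyclic_subgroup_comm lamC.
apply: lambda_comm_symmetric => // a b c.
have e := lamC (lambda a) (lambda b) (ex_intro _ a erefl) (ex_intro _ b erefl).
(* The product in [aut_group] is composition up to conversion. *)
exact: (congr1 (fun f : aut _ => f c) e).
Qed.
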